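(* Let $r\ge 2$. Every $n$-vertex $r$-graph $G$ with $e\ge n^{r-1/6^{r-1}}$ edges contains $\frac{1}{6r}(e/n)^{1/r}$ vertex-disjoint copies of the complete $r$-partite $r$-graph $K_r(s,\dots,s,t)$, where $s=\frac{1}{12}\Big(\frac{\log n}{\log(n^r/e)}\Big)^{1/(r-1)}$ and $t=n^{1/r}$.
   Context: An $r$-graph is an $r$-uniform hypergraph. $K_r(a_1,\dots,a_r)$ is the complete $r$-partite $r$-graph with vertex classes of sizes $a_1,\dots,a_r$, whose edges are all $r$-sets with exactly one vertex in each class; $K_r(s,\dots,s,t)$ has $r-1$ classes of size $s$ and one of size $t$. Non-integer quantities are rounded (floors and ceilings omitted); $n$ is assumed sufficiently large. *)

(* Defs.v *)
From HB Require Import structures.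
From mathcomp Require Import all_boot all_order all_algebra.
From mathcomp Require Import all_classical all_reals all_analysis.

Set Implicit Arguments.
Unset Strict Implicit.
Unset Printing Implicit Defensive.

Import Order.TTheory GRing.Theory Num.Theory.

Local Open Scope ring_scope.

(* A hypergraph on the vertex type V is identified with its set of edges. *)
Definition r_uniform (V : finType) (r : nat) (G : {set {set V}}) : Prop :=
  forall A : {set V}, A \in G -> #|A| = r.

(* Vertices of K_r(a_1, ..., a_r): the disjoint union of classes 'I_(a i). *)
Definition Kpartite_vertex (r : nat) (a : 'I_r -> nat) : finType :=
  {i : 'I_r & 'I_(a i)}.

Definition Kpartite (r : nat) (a : 'I_r -> nat) :
    {set {set Kpartite_vertex a}} :=
  [set A : {set Kpartite_vertex a} |
    (#|A| == r) && [forall i, #|[set x in A | tag x == i]| == 1%N]].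

(* The sizes (s, ..., s, t): the last of the r classes is the one of size t. *)
Definition sst (r s t : nat) : 'I_r -> nat :=
  fun i => if i.+1 == r then t else s.

(* A copy of H in G is an embedding onto a not necessarily induced subgraph. *)
Definition is_copy (U V : finType) (H : {set {set U}}) (G : {set {set V}})
    (f : U -> V) : Prop :=
  injective f /\ forall A : {set U}, A \in H -> f @: A \in G.

Definition has_disjoint_copies (U V : finType) (m : nat)
    (H : {set {set U}}) (G : {set {set V}}) : Prop :=
  exists f : 'I_m -> U -> V,
    (forall k, is_copy H G (f k)) /\
    (forall k l, k != l -> [disjoint f k @: [set: U] & f l @: [set: U]]).

(* All quantities rounded below are nonnegative. Rounding the number of copies
   and both class sizes up gives the strongest reading of the omitted floors
   and ceilings: copies can be dropped, and classes can be shrunk. *)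
Definition natceil (R : realType) (x : R) : nat := `|Num.ceil x|%N.

Definition s_size (R : realType) (r n e : nat) : R :=
  12%:R^-1 * (ln n%:R / ln (n%:R ^+ r / e%:R)) `^ ((r%:R - 1)^-1).

Definition t_size (R : realType) (r n : nat) : R := n%:R `^ (r%:R^-1).

Definition num_copies (R : realType) (r n e : nat) : R :=
  (6%:R * r%:R)^-1 * (e%:R / n%:R) `^ (r%:R^-1).

(* Main.v *)
Require Import Defs.
From HB Require Import structures.
From mathcomp Require Import all_boot all_order all_algebra.
From mathcomp Require Import all_classical all_reals all_analysis.
From mathcomp Require Import ring lra zify.

Set Implicit Arguments.
Unset Strict Implicit.
Unset Printing Implicit Defensive.

Import Order.TTheory GRing.Theory Num.Theory.

Local Open Scope ring_scope.

(** Write e for the number of edges. At most e^(1/r)/2 vertices have degree at least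
    D = 2r e^(1-1/r), so at most e/8 edges contain no vertex of degree below D ("light").
    Choose copies greedily, always placing the class of size t inside the light
    vertices. A copy then destroys at most tD + (r-1) s n^(r-1) edges, so while fewer
    than the required number of copies are chosen, at least 13e/25 edges avoid them and
    contain a light vertex. Reading such an edge as a tuple (x_1, ..., x_(r-1), y) with
    y light gives a subset of V^r of density about p/2 where p = e/n^r, and
    p/2 >= p^2. Blowing up the first r-1 coordinates by convexity yields s-sets
    A_1, ..., A_(r-1) completed by at least p^(2 s^(r-1)) n vertices y. The choice of s
    makes this at least n^(2/3), which exceeds t. *)

(** * Convexity of powers and averaging *)

(** Convexity without calculus: multiplying the inductive bound by [x] overshoots the next tangent
    line by a nonnegative multiple of [(x - y) ^+ 2]. *)
Lemma expr_ge_tangent (R : realDomainType) (x y : R) (n : nat) :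
  0 <= x -> 0 <= y -> y ^+ n + n%:R * y ^+ n.-1 * (x - y) <= x ^+ n.
Proof.
move=> x0 y0; elim: n => [|[|n] IH]; first by rewrite !expr0 !mul0r addr0.
  by rewrite !expr1 expr0 !mul1r addrC subrK.
apply: le_trans (_ : (y ^+ n.+1 + n.+1%:R * y ^+ n * (x - y)) * x <= _); last first.
  by rewrite [x ^+ n.+2]exprSr ler_wpM2r.
rewrite -subr_ge0.
have -> : (y ^+ n.+1 + n.+1%:R * y ^+ n * (x - y)) * x -
   (y ^+ n.+2 + n.+2%:R * y ^+ n.+2.-1 * (x - y)) =
   n.+1%:R * y ^+ n * (x - y) ^+ 2.
  by rewrite /= !exprS; ring.
by rewrite mulr_ge0 ?sqr_ge0 // mulr_ge0 ?exprn_ge0.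
Qed.

(** Power mean inequality: sum the tangent lines at [m]; their linear parts add up to something
    nonnegative because the average of [f] is at least [m]. *)
Lemma sum_expr_ge (R : realDomainType) (I : finType) (f : I -> R) (m : R) (n : nat) :
  0 <= m -> (forall i, 0 <= f i) -> m * #|I|%:R <= \sum_i f i ->
  m ^+ n * #|I|%:R <= \sum_i f i ^+ n.
Proof.
move=> m0 f0 le_m.
apply: (@le_trans _ _ (\sum_i (m ^+ n + n%:R * m ^+ n.-1 * (f i - m)))); last first.
  by apply: ler_sum => i _; exact: expr_ge_tangent.
rewrite big_split /= sumr_const -mulr_sumr sumrB sumr_const.
rewrite -[m ^+ n *+ _]mulr_natr -[m *+ _]mulr_natr.
by rewrite lerDl !mulr_ge0 ?exprn_ge0 // subr_ge0.
Qed.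

Lemma exists_ge_average (R : realDomainType) (I : finType) (P : {pred I}) (f : I -> R) (c : R) :
  (0 < #|P|)%N -> c * #|P|%:R <= \sum_(i in P) f i -> exists2 i, i \in P & c <= f i.
Proof.
move=> /card_gt0P[i0 Pi0] le_c.
have [|/pred0Pn[i /andP[Pi ci]]] := boolP (pred0b [pred i | (i \in P) && (c <= f i)]); last by exists i.
move=> /pred0P H; move: le_c; rewrite leNgt => /negP[].
rewrite mulr_natr -sumr_const.
apply: ltr_sum => [|i Pi]; first by apply/hasP; exists i0; rewrite ?mem_index_enum.
by have := H i; rewrite /= Pi /= leNgt => /negbFE.
Qed.

(** * Boxes of s-sets inside dense relations *)

Lemma subn_expn_le_ffact (d s : nat) : ((d - s) ^ s <= d ^_ s)%N.
Proof.
rewrite ffact_prod; apply: (@leq_trans (\prod_(i < s) (d - s))%N).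
  by rewrite prod_nat_const card_ord.
by apply: leq_prod => i _; rewrite leq_sub2l // ltnW.
Qed.

Lemma ffact_le_expn (n s : nat) : (n ^_ s <= n ^ s)%N.
Proof.
rewrite ffact_prod; apply: (@leq_trans (\prod_(i < s) n)%N).
  by apply: leq_prod => i _; rewrite leq_subr.
by rewrite prod_nat_const card_ord.
Qed.

Lemma sum_card_swap (I J : finType) (P : pred I) (e : I -> J -> bool) :
  (\sum_(i | P i) #|[set j | e i j]| = \sum_j #|[set i | P i && e i j]|)%N.
Proof.
under eq_bigr => i _ do rewrite -sum1dep_card.
under [RHS]eq_bigr => j _ do rewrite -sum1dep_card.
by rewrite (exchange_big_dep xpredT) //=.
Qed.

(* Convexity is applied to max(d - s, 0)^s, which bounds the falling factorial
   d^_s from below; this is where the loss s / #|X| in the density comes from. *)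
Lemma exists_dense_subset (R : realFieldType) (X Z : finType)
    (e : X -> Z -> bool) (s : nat) (a : R) :
  (0 < #|X|)%N -> (s <= #|X|)%N -> s%:R <= a * #|X|%:R ->
  a * #|X|%:R * #|Z|%:R <= \sum_z #|[set x | e x z]|%:R ->
  exists2 A : {set X}, #|A| = s &
    (a - s%:R / #|X|%:R) ^+ s * #|Z|%:R <=
      #|[set z | [forall x in A, e x z]]|%:R.
Proof.
move=> X0 sX sa dens; set n := #|X|.
have n0 : 0 < n%:R :> R by rewrite ltr0n.
pose N z := [set x | e x z].
have powmean : (a * n%:R - s%:R) ^+ s * #|Z|%:R <= \sum_z (#|N z| - s)%N%:R ^+ s.
  apply: sum_expr_ge => [|z|]; rewrite ?subr_ge0 ?ler0n //.
  apply: (@le_trans _ _ (\sum_z (#|N z|%:R - s%:R))).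
    by rewrite sumrB sumr_const mulrBl [s%:R * _]mulr_natr lerD2r.
  by apply: ler_sum => z _; rewrite lerBlDr -natrD ler_nat; lia.
pose P := [pred A : {set X} | #|A| == s].
have cardP : #|P| = 'C(n, s).
  by rewrite -(card_draws X s) cardsE; apply: eq_card => A; rewrite !inE.
have [||A PA le_A] := @exists_ge_average R _ P
   (fun A => #|[set z | [forall x in A, e x z]]|%:R)
   ((a - s%:R / n%:R) ^+ s * #|Z|%:R).
- by rewrite cardP bin_gt0.
- rewrite -natr_sum sum_card_swap cardP.
  have -> : (\sum_z #|[set A : {set X} | (A \in P) && [forall x in A, e x z]]| =
     \sum_z 'C(#|N z|, s))%N.
    apply: eq_bigr => z _; rewrite -cards_draws; apply: eq_card => A.
    rewrite !inE andbC; congr (_ && _).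
    apply/forall_inP/fintype.subsetP => H x xA; last by have := H x xA; rewrite inE.
    by rewrite inE H.
  have fs0 : 0 < s`!%:R :> R by rewrite ltr0n fact_gt0.
  rewrite -(ler_pM2r fs0) -mulrA -natrM bin_ffact -natrM big_distrl /=.
  under eq_bigr => z _ do rewrite bin_ffact.
  apply: (@le_trans _ _ (\sum_z (#|N z| - s)%N%:R ^+ s)); last first.
    rewrite natr_sum; apply: ler_sum => z _.
    by rewrite -natrX ler_nat subn_expn_le_ffact.
  apply: le_trans powmean.
  have -> : a * n%:R - s%:R = (a - s%:R / n%:R) * n%:R.
    by rewrite mulrBl mulfVK // gt_eqF.
  rewrite exprMn mulrAC ler_wpM2r ?ler0n //.
  rewrite ler_wpM2l ?exprn_ge0 //; first by rewrite subr_ge0 ler_pdivrMr.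
  by rewrite -natrX ler_nat ffact_le_expn.
by exists A => //; apply/eqP.
Qed.

(** Splitting off the first coordinate presents a relation on tuples as a bipartite relation between
    [V] and the remaining data, the form in which one coordinate can be blown up. *)
Lemma card_cons_tuple (V Y : finType) (k : nat) (e : seq V -> Y -> bool) :
  (#|[set u : k.+1.-tuple V * Y | e u.1 u.2]| =
   \sum_(z : k.-tuple V * Y) #|[set x | e (x :: z.1) z.2]|)%N.
Proof.
rewrite -sum1dep_card.
under [RHS]eq_bigr => z _ do rewrite -sum1dep_card.
rewrite (pair_big_dep xpredT (fun (z : k.-tuple V * Y) x => e (x :: z.1) z.2)) /=.
pose h (p : k.-tuple V * Y * V) : k.+1.-tuple V * Y := ([tuple of p.2 :: p.1.1], p.1.2).
rewrite (reindex h) //=.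
exists (fun u : k.+1.-tuple V * Y => ([tuple of behead u.1], u.2, thead u.1)).
  by move=> [[t y] x] _; rewrite /h /=; congr (_, _, _); apply: val_inj.
by move=> [t y] _; rewrite /h /= -tuple_eta.
Qed.

(* One coordinate at a time: a density b drops to (b - s/#|V|)^s, and h absorbs
   the loss s/#|V| as a factor 1 - h. *)
Lemma dense_box (R : realFieldType) (V Y : finType) (k s : nat)
    (e : seq V -> Y -> bool) (a h : R) :
  (0 < s)%N -> (0 < #|V|)%N -> 0 <= h <= 1 -> 0 <= a <= 1 ->
  s%:R <= h * ((1 - h) ^+ k * a) ^+ (s ^ k) * #|V|%:R ->
  a * #|V|%:R ^+ k * #|Y|%:R <= #|[set u : k.-tuple V * Y | e u.1 u.2]|%:R ->
  exists A : nat -> {set V}, (forall i, #|A i| = s) /\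
    ((1 - h) ^+ k * a) ^+ (s ^ k) * #|Y|%:R <=
    #|[set y | [forall t : k.-tuple V, [forall i : 'I_k, tnth t i \in A i] ==> e t y]]|%:R.
Proof.
move=> s0 V0 /andP[h0 h1]; have n0 : 0 < #|V|%:R :> R by rewrite ltr0n.
have le1 : forall k a, 0 <= a <= 1 -> 0 <= (1 - h) ^+ k * a <= 1.
  move=> j b /andP[b0 b1]; rewrite mulr_ge0 ?exprn_ge0 ?subr_ge0 //=.
  by rewrite mulr_ile1 ?exprn_ge0 ?subr_ge0 // exprn_ile1 ?subr_ge0 // gerBl.
elim: k e a => [|k IH] e a a01.
  rewrite expn0 !expr1 !expr0 !mul1r mulr1 => le_s dens.
  have sV : (s <= #|V|)%N.
    rewrite -(ler_nat R) (le_trans le_s) // ger_pMl //.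
    by have /andP[? ?] := a01; rewrite mulr_ile1.
  have /card_gt0P[A] : (0 < #|[set A : {set V} | #|A| == s]|)%N.
    by rewrite card_draws bin_gt0.
  rewrite inE => /eqP cA; exists (fun=> A); split=> //.
  apply: le_trans dens _; rewrite ler_nat.
  apply: (@leq_trans #|[set y | e [::] y]|); last first.
    apply/subset_leq_card/fintype.subsetP => y; rewrite !inE => ey.
    by apply/forallP => t; rewrite tuple0 ey implybT.
  rewrite -(card_imset (mem [set y | e [::] y]) (f := fun y => ([tuple] : 0.-tuple V, y))).
    apply/subset_leq_card/fintype.subsetP => -[t y]; rewrite inE /= tuple0 => ey.
    by apply/imsetP; exists y; rewrite ?inE.
  by move=> y y' [].
move=> le_s dens.
set b := ((1 - h) * a) ^+ s.
have b01 : 0 <= b <= 1.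
  have /andP[] := le1 1%N _ a01; rewrite expr1 => ? ?.
  by rewrite /b exprn_ge0 //= exprn_ile1.
have hj j : 0 <= (1 - h) ^+ j by rewrite exprn_ge0 ?subr_ge0.
have eb : ((1 - h) ^+ k.+1 * a) ^+ (s ^ k.+1) = ((1 - h) ^+ (k * s) * b) ^+ (s ^ k).
  by rewrite /b expnS exprM exprM -exprMn; congr (_ ^+ _ ^+ _); rewrite exprSr mulrA.
(* Once the first coordinate is blown up, the induction hypothesis yields the right-hand side. By
   [eb] the target has [(1 - h) ^+ (k * s)] in place of [(1 - h) ^+ k], which is no larger since
   [0 < s]. *)
have le_b : ((1 - h) ^+ k.+1 * a) ^+ (s ^ k.+1) <= ((1 - h) ^+ k * b) ^+ (s ^ k).
  have /andP[? _] := b01.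
  rewrite eb; apply: lerXn2r; rewrite ?nnegrE; [exact: mulr_ge0..|].
  rewrite ler_wpM2r // ler_wiXn2l ?subr_ge0 ?gerBl //.
  by rewrite leq_pmulr.
have le_sa : s%:R <= h * a * #|V|%:R.
  apply: le_trans le_s _; rewrite ler_wpM2r ?ler0n // ler_wpM2l //.
  have /andP[? ?] := le1 k.+1 _ a01; have /andP[? _] := a01.
  apply: le_trans (ler_iXnr _ _ _) _; rewrite ?expn_gt0 ?s0 //.
  by rewrite ler_piMl // exprn_ile1 ?subr_ge0 ?gerBl.
have /andP[a0 a1] := a01.
have [||||A0 cA0 dens0] := @exists_dense_subset R V (k.-tuple V * Y)%type
   (fun x z => e (x :: z.1) z.2) s a.
- by [].
- rewrite -(ler_nat R) (le_trans le_sa) // ger_pMl //.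
  by rewrite mulr_ile1.
- by rewrite (le_trans le_sa) // ler_wpM2r // ler_piMl.
- rewrite -natr_sum -card_cons_tuple; apply: le_trans dens.
  by rewrite card_prod card_tuple natrM natrX exprS !mulrA.
have [||A [cA denA]] := IH (fun t y => [forall x in A0, e (x :: t) y]) b b01.
- by rewrite (le_trans le_s) // ler_wpM2r // ler_wpM2l.
- apply: le_trans dens0; rewrite card_prod card_tuple natrM natrX mulrA.
  rewrite !ler_wpM2r ?exprn_ge0 ?ler0n //.
  apply: lerXn2r; rewrite ?nnegrE ?mulr_ge0 ?subr_ge0 ?ler_pdivrMr //.
    by rewrite (le_trans le_sa) // ler_wpM2r // ler_piMl.
  rewrite mulrBl mul1r lerD2l lerN2 ler_pdivrMr //.
exists (fun i => if i is j.+1 then A j else A0); split; first by case.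
apply: le_trans (ler_wpM2r (ler0n _ _) le_b) _; apply: le_trans denA _.
rewrite ler_nat; apply/subset_leq_card/fintype.subsetP => y; rewrite !inE => /forallP H.
apply/forallP => u; case/tupleP: u => x t; apply/implyP => /forallP tA.
have /implyP/(_ _)/forall_inP := H t; apply.
  by apply/forallP => i; have := tA (lift ord0 i); rewrite tnthS.
by have := tA ord0; rewrite tnth0.
Qed.

(** * From boxes to copies *)

(* The classes B i need not be assumed disjoint: a vertex common to two of them
   would give an edge with fewer than r vertices. *)
Lemma copy_of_classes (V : finType) (r : nat) (a : 'I_r -> nat)
    (G : {set {set V}}) (B : 'I_r -> {set V}) :
  r_uniform r G -> (forall i, 0 < a i)%N -> (forall i, #|B i| = a i) ->
  (forall x : 'I_r -> V, (forall i, x i \in B i) ->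
     [set x i | i in finset.setT] \in G) ->
  exists f : Kpartite_vertex a -> V, [/\ is_copy (Kpartite a) G f,
    forall u, f u \in B (tag u) & forall u, exists2 A, A \in G & f u \in A].
Proof.
move=> unifG a0 cB boxG.
pose f (u : Kpartite_vertex a) := enum_val (cast_ord (esym (cB (tag u))) (tagged u)).
have fB u : f u \in B (tag u) by exact: enum_valP.
pose other i : Kpartite_vertex a := Tagged (fun i => 'I_(a i)) (Ordinal (a0 i)).
(* A transversal through both [f u] and [f w], filled up by default vertices. If [f u = f w] with
   distinct tags, its image would be an edge with fewer than r vertices. *)
pose x (u w : Kpartite_vertex a) i := if i == tag u then f u else if i == tag w then f w else f (other i).
have xB u w i : x u w i \in B i.
  rewrite /x; case: eqP => [->|_] //; case: eqP => [->|_] //; exact: fB.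
exists f; split=> //; last first.
  move=> u; exists [set x u u i | i in finset.setT]; first exact: boxG.
  by apply/imsetP; exists (tag u); rewrite ?inE // /x eqxx.
split.
  move=> u w fuw.
  have tuw : tag u = tag w.
    have /unifG cx := boxG _ (xB u w).
    have inj : {in [set: 'I_r] &, injective (x u w)}.
      by apply/imset_injP; rewrite cx cardsT card_ord.
    apply: inj; rewrite ?inE // /x eqxx fuw; case: eqP => // _; first by rewrite eqxx.
  case: u w tuw fuw => i j [i' j'] /= e; case: _ / e j' => j'.
  by rewrite /f /= => /enum_val_inj/cast_ord_inj ->.
move=> A; rewrite inE => /andP[_ /forallP cA].
have /fin_all_exists[g gA] : forall i : 'I_r, exists u, [set u in A | tag u == i] = [set u].
  by move=> i; apply/cards1P.
have gP i : (g i \in A) && (tag (g i) == i).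
  by have := set11 (g i); rewrite -gA inE.
have -> : f @: A = [set f (g i) | i in finset.setT].
  apply/setP => v; apply/imsetP/imsetP => [[u uA ->]|[i _ ->]].
    exists (tag u); rewrite ?inE //; congr f.
    by apply/set1P; rewrite -gA inE uA eqxx.
  by exists (g i) => //; have /andP[] := gP i.
by apply: boxG => i; have /andP[_ /eqP {2}<-] := gP i.
Qed.

Lemma exists_subset_card (T : finType) (B : {set T}) (s : nat) :
  (s <= #|B|)%N -> exists2 A : {set T}, A \subset B & #|A| = s.
Proof.
rewrite -bin_gt0 -cards_draws => /card_gt0P[A]; rewrite inE => /andP[AB /eqP cA].
by exists A.
Qed.

(** * Degrees and edges meeting a vertex set *)

Lemma card_bigcup_le (I T : finType) (F : I -> {set T}) :
  (#|\bigcup_i F i| <= \sum_i #|F i|)%N.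
Proof.
elim/big_ind2: _ => [|D d D' d' le_D le_D'|//]; first by rewrite cards0.
by rewrite (leq_trans (leq_card_setU _ _)) // leq_add.
Qed.

(** Deleting [v] is injective on the edges through [v] and leaves r-subsets of [V]. *)
Lemma degree_le (V : finType) (r : nat) (G : {set {set V}}) (v : V) :
  r_uniform r.+1 G -> (#|[set A in G | v \in A]| <= #|V| ^ r)%N.
Proof.
move=> unifG; set Gv := [set A in G | _].
have inj : {in Gv &, injective (fun A => A :\ v)}.
  move=> A A'; rewrite !inE => /andP[_ vA] /andP[_ vA'] e.
  by rewrite -(finset.setD1K vA) -(finset.setD1K vA') e.
rewrite -(card_in_imset inj).
apply: (@leq_trans #|[set B : {set V} | #|B| == r]|).
  apply/subset_leq_card/fintype.subsetP => _ /imsetP[A AG ->]; rewrite inE.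
  move: AG; rewrite inE => /andP[/unifG cA vA].
  by have := cardsD1 v A; rewrite vA cA add1n => -[->].
rewrite card_draws (leq_trans _ (ffact_le_expn _ _)) // -bin_ffact.
by rewrite leq_pmulr // fact_gt0.
Qed.

Lemma sum_degree (V : finType) (r : nat) (G : {set {set V}}) :
  r_uniform r G -> (\sum_v #|[set A in G | v \in A]| = r * #|G|)%N.
Proof.
move=> unifG; rewrite (sum_card_swap xpredT (fun v A => (A \in G) && (v \in A))) /=.
rewrite mulnC -sum_nat_const [RHS]big_mkcond; apply: eq_bigr => A _.
case: ifP => AG; last by apply: eq_card0 => v; rewrite inE.
by rewrite -(unifG A AG); apply: eq_card => v; rewrite inE.
Qed.

Lemma card_edges_meeting (V : finType) (G : {set {set V}}) (W : {set V}) :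
  (#|[set A in G | ~~ [disjoint A & W]]| <= \sum_(v in W) #|[set A in G | v \in A]|)%N.
Proof.
rewrite (sum_card_swap (mem W) (fun v A => (A \in G) && (v \in A))) /=.
rewrite -sum1_card big_mkcond; apply: leq_sum => A _.
rewrite inE; case: ifP => // /andP[AG /pred0Pn[v /andP[/= vA vW]]].
by rewrite card_gt0; apply/set0Pn; exists v; rewrite inE vW AG vA.
Qed.

(** * Greedy choice of disjoint copies *)

(** The predicate [good] lets the induction carry a bound on the edges destroyed by each earlier
    copy, besides its being a copy. *)
Lemma greedy_disjoint (U V : finType) (m : nat) (good : (U -> V) -> Prop) :
  (forall j, (j < m)%N -> forall f : 'I_j -> U -> V, (forall i, good (f i)) ->
     exists2 g, good g & forall i, [disjoint g @: [set: U] & f i @: [set: U]]) ->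
  exists f : 'I_m -> U -> V, (forall i, good (f i)) /\
    forall i j, i != j -> [disjoint f i @: [set: U] & f j @: [set: U]].
Proof.
move=> step.
suff : forall j, (j <= m)%N -> exists f : 'I_j -> U -> V, (forall i, good (f i)) /\
    forall i i', i != i' -> [disjoint f i @: [set: U] & f i' @: [set: U]].
  by move=> /(_ m (leqnn m)).
elim=> [_|j IH jm].
  by exists (fun i : 'I_0 => False_rect _ (notF (ltn_ord i))); split=> -[].  
have [f [goodf disf]] := IH (ltnW jm).
have [g goodg disg] := step j jm f goodf.
exists (fun i => if unlift ord_max i is Some i' then f i' else g); split.
  by move=> i; case: unliftP.
move=> i i'; case: unliftP => [l ->|->]; case: unliftP => [l' ->|->].
- by rewrite (inj_eq lift_inj); exact: disf.
- by rewrite disjoint_sym.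
- by [].
- by rewrite eqxx.
Qed.

Lemma edges_le_tuples (V : finType) (k : nat) (G : {set {set V}}) (L : {set V}) :
  r_uniform k.+1 G -> (forall A, A \in G -> ~~ [disjoint A & L]) ->
  (#|G| <= #|[set u : k.-tuple V * V | (u.2 \in L) && ([set z in u.2 :: u.1] \in G)]|)%N.
Proof.
move=> unifG meetG.
pose h (u : k.-tuple V * V) := [set z in u.2 :: u.1].
apply: leq_trans (leq_imset_card h _).
apply/subset_leq_card/fintype.subsetP => A AG; apply/imsetP.
have /pred0Pn[y /andP[/= yA yL]] := meetG A AG.
have sz : size (enum (A :\ y)) == k.
  by rewrite -cardE; have := cardsD1 y A; rewrite yA (unifG A AG) add1n => -[->].
have hA : [set z in y :: Tuple sz] = A.
  by apply/setP => z; rewrite !inE mem_enum !inE; case: eqP => // ->.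
by exists (Tuple sz, y); rewrite ?inE /= ?yL /h /= hA.
Qed.

(** Apply [dense_box] to the edges that avoid [W] and meet [L]. The sets [B] and [C] are kept in the
    conclusion because they are charged differently: vertices of [B] by the trivial degree bound,
    those of [C] by the degree bound on [L]. *)
Lemma exists_copy (R : realFieldType) (V : finType) (k s t : nat)
    (G : {set {set V}}) (W L : {set V}) (a h : R) :
  r_uniform k.+1 G -> (0 < s)%N -> (0 < t)%N -> (0 < #|V|)%N ->
  0 <= h <= 1 -> 0 <= a <= 1 ->
  s%:R <= h * ((1 - h) ^+ k * a) ^+ (s ^ k) * #|V|%:R ->
  t%:R <= ((1 - h) ^+ k * a) ^+ (s ^ k) * #|V|%:R ->
  a * #|V|%:R ^+ k.+1 <=
    #|[set A in G | [disjoint A & W] && ~~ [disjoint A & L]]|%:R ->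
  exists f : Kpartite_vertex (@sst k.+1 s t) -> V,
    [/\ is_copy (Kpartite (@sst k.+1 s t)) G f, forall u, f u \notin W &
     exists B C : {set V}, [/\ (#|B| <= k * s)%N, #|C| = t, C \subset L &
       forall u, f u \in B :|: C]].
Proof.
move=> unifG s0 t0 V0 h01 a01 les le_t dens.
set G' := [set A in G | _] in dens.
have G'G A : A \in G' -> A \in G by rewrite inE => /andP[].
pose e (q : seq V) (y : V) := (y \in L) && ([set z in y :: q] \in G').
have [|A [cA]] := dense_box (e := e) s0 V0 h01 a01 les.
  rewrite -mulrA -exprSr; apply: le_trans dens _; rewrite ler_nat.
  apply: edges_le_tuples => [A /G'G|A]; first exact: unifG.
  by rewrite inE => /and3P[].
set Y := [set y | _] => cY.
have [C CY cC] : exists2 C : {set V}, C \subset Y & #|C| = t.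
  by apply: exists_subset_card; rewrite -(ler_nat R); exact: le_trans cY.
(* One tuple in the box is needed to read [y \in L] off the relation [e]. *)
have /fin_all_exists[g gA] : forall i : 'I_k, exists v, v \in A i.
  by move=> i; apply/set0Pn; rewrite -card_gt0 cA.
have CE y q : y \in C -> (forall i : 'I_k, tnth q i \in A i) -> e q y.
  move=> /(fintype.subsetP CY); rewrite inE => /forallP/(_ q)/implyP H qA.
  by apply: H; apply/forallP.
pose B (i : 'I_k.+1) := if i.+1 == k.+1 then C else A i.
have [||i|x xB|f [copyf fB fG']] := @copy_of_classes V k.+1 (@sst k.+1 s t) G' B.
- by move=> D /G'G /unifG.
- by move=> i; rewrite /sst; case: ifP.
- by rewrite /B /sst; case: ifP.
- have xC : x ord_max \in C by have := xB ord_max; rewrite /B eqxx.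
  have xA (i : 'I_k) : tnth [tuple x (widen_ord (leqnSn k) i) | i < k] i \in A i.
    rewrite tnth_mktuple; have := xB (widen_ord (leqnSn k) i).
    by rewrite /B /= eqSS (ltn_eqF (ltn_ord i)).
  have /andP[_] := CE _ _ xC xA.
  congr (_ \in G'); apply/setP => v; rewrite inE in_cons.
  apply/orP/imsetP => [[/eqP ->|/mapP[i _ ->]]|[i _ ->]].
  + by exists ord_max.
  + by exists (widen_ord (leqnSn k) i).
  + case: (unliftP ord_max i) => [j ->|->]; [right|by left].
    apply/mapP; exists j; rewrite ?mem_enum //; congr x; apply: val_inj.
    by rewrite /= /bump leqNgt ltn_ord.
exists f; split.
- by case: copyf => injf Gf; split=> // D /Gf /G'G.
- move=> u; have [D] := fG' u; rewrite inE => /and3P[_ disD _] uD.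
  by have := disjointFr disD uD => ->.
exists (\bigcup_(i < k) A i), C; split=> //.
- rewrite (leq_trans (card_bigcup_le _)) //.
  by under eq_bigr do rewrite cA; rewrite sum_nat_const card_ord.
- apply/fintype.subsetP => y yC; have gA' i : tnth [tuple g i | i < k] i \in A i.
    by rewrite tnth_mktuple.
  by have /andP[] := CE _ _ yC gA'.
move=> u; rewrite inE; have := fB u; rewrite /B; case: eqP => [_ ->|ku fA].
  by rewrite orbT.
apply/orP; left; apply/bigcupP.
have uk : (tag u < k)%N by have := ltn_ord (tag u); rewrite ltnS leq_eqVlt => /orP[/eqP e'|//]; case: ku; rewrite e'.
by exists (Ordinal uk).
Qed.

(* With x = e^(1/r), at most x/2 vertices have degree at least 2re/x, and they
   span at most (x/2)^r / r! edges. *)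
Lemma card_heavy_edges (R : realFieldType) (V : finType) (k : nat)
    (G : {set {set V}}) (x : R) :
  r_uniform k.+2 G -> 0 < x -> x ^+ k.+2 = #|G|%:R ->
  #|[set A in G | [disjoint A &
      [set v | #|[set A in G | v \in A]|%:R < 2 * k.+2%:R * #|G|%:R / x]]]|%:R
    <= #|G|%:R / 8 :> R.
Proof.
move=> unifG x0 xG; set e : R := #|G|%:R; set D := 2 * _ * _ / x.
set L := [set v | _ < _]; set K := [set A in G | _].
have e0 : 0 < e by rewrite /e -xG exprn_gt0.
have D0 : 0 < D by rewrite /D divr_gt0 // !mulr_gt0.
(* The degrees sum to r e, and each vertex outside [L] contributes at least [D] = 2re/x. *)
have cH : #|~: L|%:R <= x / 2.
  have : #|~: L|%:R * D <= k.+2%:R * e.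
    rewrite /e -natrM -(sum_degree unifG) natr_sum mulr_natl -sumr_const.
    rewrite [leRHS](bigID (mem (~: L))) /= -[leLHS]addr0 lerD //.
      by apply: ler_sum => v; rewrite !inE -leNgt.
    by apply: sumr_ge0 => v _; rewrite ler0n.
  rewrite /D mulrA ler_pdivrMr // => le_H.
  rewrite -(ler_pM2r (_ : 0 < 2 * k.+2%:R * e)) ?mulr_gt0 //.
  by apply: le_trans le_H _; rewrite le_eqVlt; apply/orP; left; apply/eqP; field.
have cK : (#|K| * (k.+2)`! <= #|~: L| ^ k.+2)%N.
  apply: leq_trans (ffact_le_expn _ _); rewrite -bin_ffact leq_mul2r; apply/orP; right.
  rewrite -cards_draws; apply/subset_leq_card/fintype.subsetP => A; rewrite !inE.
  by move=> /andP[AG dAL]; rewrite -finset.disjoints_subset dAL unifG /=.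
have f2 : 2 <= (k.+2)`!%:R :> R.
  by rewrite ler_nat factS -[leqLHS]muln1 leq_mul ?fact_gt0.
have : #|K|%:R * 2 <= e / 2 ^+ k.+2.
  apply: (@le_trans _ _ (#|K|%:R * (k.+2)`!%:R)); first by rewrite ler_wpM2l.
  rewrite -natrM; apply: (@le_trans _ _ (#|~: L|%:R ^+ k.+2)).
    by rewrite -natrX ler_nat.
  rewrite /e -xG -expr_div_n; apply: lerXn2r cH; rewrite ?nnegrE ?ler0n //.
  by rewrite divr_ge0 // ltW.
have : e / 2 ^+ k.+2 <= e / 4.
  rewrite ler_pM2l // lef_pV2 ?posrE ?exprn_gt0 // !exprS.
  have : 1 <= 2 ^+ k :> R by rewrite exprn_ege1 // ler1n.
  by lra.
by lra.
Qed.

(** Each copy meets at most [c] edges, so after [j] copies an edge meeting [L] either avoids them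
    all or is among at most [j * c] destroyed ones; the density hypothesis leaves enough for
    [exists_copy]. *)
Lemma disjoint_copies (R : realFieldType) (V : finType) (k s t m : nat)
    (G : {set {set V}}) (L : {set V}) (a h D : R) :
  r_uniform k.+1 G -> (0 < s)%N -> (0 < t)%N -> (0 < #|V|)%N ->
  0 <= h <= 1 -> 0 <= a <= 1 ->
  s%:R <= h * ((1 - h) ^+ k * a) ^+ (s ^ k) * #|V|%:R ->
  t%:R <= ((1 - h) ^+ k * a) ^+ (s ^ k) * #|V|%:R ->
  {in L, forall v, #|[set A in G | v \in A]|%:R <= D} ->
  (forall j, (j < m)%N ->
    j%:R * (k%:R * s%:R * #|V|%:R ^+ k + t%:R * D) + a * #|V|%:R ^+ k.+1 <=
    #|[set A in G | ~~ [disjoint A & L]]|%:R) ->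
  has_disjoint_copies m (Kpartite (@sst k.+1 s t)) G.
Proof.
move=> unifG s0 t0 V0 h01 a01 les le_t degL dens.
set U := Kpartite_vertex (@sst k.+1 s t).
pose hit (f : U -> V) := [set A in G | ~~ [disjoint A & f @: [set: U]]].
pose c : R := k%:R * s%:R * #|V|%:R ^+ k + t%:R * D.
pose good f := is_copy (Kpartite (@sst k.+1 s t)) G f /\ #|hit f|%:R <= c.
suff [f [goodf disf]] : exists f : 'I_m -> U -> V, (forall i, good (f i)) /\
    forall i j, i != j -> [disjoint f i @: [set: U] & f j @: [set: U]].
  by exists f; split=> // i; have [] := goodf i.
apply: greedy_disjoint => j jm f goodf.
set W := \bigcup_i f i @: [set: U].
have [|g [copyg gW [B [C [cB cC CL gBC]]]]] :=
    exists_copy (W := W) (L := L) unifG s0 t0 V0 h01 a01 les le_t.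
  set G1 := [set A in G | _ && _].
  have := dens j jm; set G2 := [set A in G | _]; rewrite -/c => le_G2.
  have : (#|G2| <= #|G1| + \sum_i #|hit (f i)|)%N.
    apply: leq_trans (_ : #|G1 :|: \bigcup_i hit (f i)| <= _)%N; last first.
      by rewrite (leq_trans (leq_card_setU _ _)) // leq_add2l card_bigcup_le.
    apply/subset_leq_card/fintype.subsetP => A; rewrite !inE => /andP[AG ->].
    rewrite AG andbT /=; case: (boolP [disjoint A & W]) => //= /pred0Pn[v /andP[/= vA]].
    move=> /bigcupP[i _ vi]; apply/bigcupP; exists i => //; rewrite inE AG /=.
    by apply/pred0Pn; exists v; rewrite /= vA.
  rewrite -(ler_nat R) natrD natr_sum => le_hit.
  have : \sum_i #|hit (f i)|%:R <= j%:R * c.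
    rewrite -[j in leRHS]card_ord mulr_natl -sumr_const.
    by apply: ler_sum => i _; have [] := goodf i.
  by lra.
have D0 : 0 <= D.
  have /card_gt0P[v /(fintype.subsetP CL) vL] : (0 < #|C|)%N by rewrite cC.
  by apply: le_trans (degL v vL); rewrite ler0n.
exists g => [|i].
  split=> //; apply: (@le_trans _ _ (\sum_(v in B :|: C) #|[set A in G | v \in A]|%:R)).
    rewrite -natr_sum ler_nat; apply: leq_trans (card_edges_meeting _ _).
    apply/subset_leq_card/fintype.subsetP => A; rewrite !inE => /andP[-> /pred0Pn[v /andP[/= vA]]].
    by move=> /imsetP[u _ vu]; apply/pred0Pn; exists v; rewrite /= vA vu gBC.
  apply: (@le_trans _ _ (\sum_(v in B) #|[set A in G | v \in A]|%:R +
      \sum_(v in C) #|[set A in G | v \in A]|%:R)).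
    rewrite [leLHS](bigID (mem B)) /= lerD //.
      rewrite [leLHS](eq_bigl (mem B)) // => v; rewrite /= !inE.
      by case: (v \in B); rewrite ?andbT ?andbF.
    rewrite [leRHS](bigID (mem B)) /= -[leLHS]add0r lerD //.
      by apply: sumr_ge0 => v _; rewrite ler0n.
    rewrite le_eqVlt; apply/orP; left; apply/eqP/eq_bigl => v; rewrite /= !inE.
    by case: (v \in B); rewrite ?andbF.
  rewrite lerD //; last first.
    rewrite -cC mulr_natl -sumr_const; apply: ler_sum => v vC.
    by apply/degL/(fintype.subsetP CL).
  apply: (@le_trans _ _ (\sum_(v in B) #|V|%:R ^+ k)).
    by apply: ler_sum => v _; rewrite -natrX ler_nat degree_le.
  by rewrite sumr_const -[leLHS]mulr_natl -natrM ler_wpM2r ?exprn_ge0 // ler_nat.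
apply/pred0Pn => -[v /andP[/= /imsetP[u _ ->] gi]].
by have /negP := gW u; apply; apply/bigcupP; exists i.
Qed.

(** * Rounding, growth rates and the size s *)

Lemma ltn_natceil (R : realType) (x : R) (j : nat) :
  0 <= x -> (j < natceil x)%N = (j%:R < x).
Proof.
move=> x0; rewrite -[RHS](ceil_gt_int x j%:Z) /natceil -ltz_nat gez0_abs //.
by rewrite ceil_ge0 (lt_le_trans _ x0).
Qed.

Lemma natceil_ge (R : realType) (x : R) : 0 <= x -> x <= (natceil x)%:R.
Proof. by move=> x0; rewrite leNgt -ltn_natceil // ltnn. Qed.

Lemma natceil_lt (R : realType) (x : R) : 0 <= x -> (natceil x)%:R < x + 1.
Proof.
move=> x0; case E : (natceil x) => [|j]; first by lra.
by rewrite -natr1 ltrD2r -ltn_natceil // E.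
Qed.

Lemma natceil_le_double (R : realType) (x : R) :
  1 / 2 <= x -> (natceil x)%:R <= 2 * x.
Proof.
move=> x2; have x0 : 0 <= x by lra.
case E : (natceil x) => [|[|j]]; [by lra..|].
have : j.+1%:R < x by rewrite -ltn_natceil // E.
by have : 0 <= j%:R :> R by []; rewrite -!natr1; lra.
Qed.

Lemma powR_ge_eventually (R : realType) (c d : R) :
  0 < d -> exists n0, forall n, (n0 <= n)%N -> c <= n%:R `^ d.
Proof.
move=> d0; exists (natceil (`|c| `^ d^-1)) => n le_n.
apply: le_trans (ler_norm c) _.
have -> : `|c| = (`|c| `^ d^-1) `^ d by rewrite -powRrM mulVf ?powRr1 ?lt0r_neq0.
apply: ge0_ler_powR; rewrite ?nnegrE ?powR_ge0 ?(ltW d0) //.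
by apply: le_trans (natceil_ge (powR_ge0 _ _)) _; rewrite ler_nat.
Qed.

Lemma ln_le_powR_eventually (R : realType) (c d : R) :
  0 < c -> 0 < d -> exists n0, forall n, (n0 <= n)%N -> ln n%:R <= c * n%:R `^ d.
Proof.
move=> c0 d0.
have [|n0 le_n0] := @powR_ge_eventually R (2 / (c * d)) (d / 2); first by lra.
exists n0.+1 => n n0n; have /le_n0 := ltnW n0n; set y := _ `^ _ => le_y.
have n_gt0 : 0 < n%:R :> R by rewrite ltr0n (leq_trans _ n0n).
have y0 : 0 < y by rewrite powR_gt0.
have -> : n%:R `^ d = y * y.
  rewrite /y -powRD ?(lt0r_neq0 n_gt0) ?implybT //; congr (_ `^ _); lra.
have lny : ln n%:R = 2 / d * ln y.
  by rewrite /y ln_powR; field; rewrite lt0r_neq0.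
rewrite lny; apply: (@le_trans _ _ (2 / d * y)).
  by rewrite ler_wpM2l ?divr_ge0 ?ltW // ln_sublinear.
rewrite mulrA ler_wpM2r ?(ltW y0) //.
move: le_y; rewrite ler_pdivrMr ?mulr_gt0 // => le_y.
by rewrite ler_pdivrMr //; lra.
Qed.

(* The unrounded size is at least 1/2, so rounding up at most doubles it; this
   turns the constant 1/12 into 1/6. *)
Lemma s_size_bounds (R : realType) (k n e : nat) :
  (0 < k)%N -> (0 < n)%N -> (0 < e)%N -> e%:R <= n%:R ^+ k.+1 / 2 :> R ->
  n%:R `^ (k.+1%:R - 1 / 6 ^+ k) <= e%:R :> R ->
  let s := natceil (s_size R k.+1 n e) in
  [/\ (0 < s)%N, s%:R <= ln n%:R :> R &
    1 <= (e%:R / n%:R ^+ k.+1) ^+ ((6 * s) ^ k) * n%:R :> R].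
Proof.
move=> k0 n0 e0 le_e ge_e s.
set N : R := n%:R in le_e ge_e *; set p := e%:R / _.
have N0 : 0 < N by rewrite /N ltr0n.
have E0 : 0 < e%:R :> R by rewrite ltr0n.
have p0 : 0 < p by rewrite /p divr_gt0 ?exprn_gt0.
have p2 : p <= 1 / 2.
  by rewrite /p ler_pdivrMr ?exprn_gt0 //; lra.
pose l := ln (N ^+ k.+1 / e%:R).
have lE : l = - ln p by rewrite /l -lnV ?posrE // /p invf_div.
have l2 : 1 / 2 <= l.
  have : ln (1 + (p - 1)) <= p - 1 by apply: le_ln1Dx; lra.
  by rewrite lE addrC subrK; lra.
have l0 : 0 < l by lra.
have six0 : 0 < 6 ^+ k :> R by rewrite exprn_gt0.
(* The exponent 1/6^(r-1) of the edge bound enters here: it gives [6 ^+ k <= x], hence [6 <= y], so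
   the unrounded size y/12 is at least 1/2. *)
have lnN : 6 ^+ k * l <= ln N.
  have : ln (N `^ (k.+1%:R - 1 / 6 ^+ k)) <= ln e%:R.
    by rewrite ler_ln ?posrE ?powR_gt0.
  rewrite ln_powR /l ln_div ?posrE ?exprn_gt0 // lnXn // -[ln N *+ _]mulr_natr => H.
  rewrite mulrC -ler_pdivlMr //; lra.
pose x := ln N / l; pose y := x `^ ((k.+1%:R - 1)^-1).
have kE : k.+1%:R - 1 = k%:R :> R by rewrite -natr1 addrK.
have x6 : 6 ^+ k <= x by rewrite /x ler_pdivlMr.
have x0 : 0 <= x by rewrite (le_trans _ x6) // ltW.
have yk : y ^+ k = x.
  rewrite /y kE -powR_mulrn ?powR_ge0 // -powRrM mulVf ?powRr1 //.
  by rewrite pnatr_eq0 -lt0n.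
have y6 : 6 <= y.
  by rewrite -(ler_pXn2r k0) ?nnegrE ?powR_ge0 // yk.
have sE : s = natceil (y / 12) by rewrite /s /s_size -/N -/l -/x -/y mulrC.
have s6 : 6 * s%:R <= y.
  have : s%:R <= 2 * (y / 12) by rewrite sE natceil_le_double //; lra.
  by lra.
have y12 : 0 < y / 12 by lra.
have s0 : (0 < s)%N by rewrite sE ltn_natceil // ltW.
have s1 : 1 <= s%:R :> R by rewrite ler1n.
have s6l : (6 * s%:R) ^+ k * l <= ln N.
  rewrite -ler_pdivlMr // -/x -yk lerXn2r ?nnegrE ?mulr_ge0 ?powR_ge0 //.
split=> //.
  have : 6 * s%:R * l <= (6 * s%:R) ^+ k * l.
    rewrite ler_wpM2r ?(ltW l0) // ler_eXnr // ?k0 //.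
    by lra.
  have : s%:R * (1 / 2) <= s%:R * l by rewrite ler_wpM2l.
  by lra.
rewrite -ler_ln ?posrE ?mulr_gt0 ?exprn_gt0 // ln1.
rewrite lnM ?posrE ?exprn_gt0 // lnXn // -mulr_natr natrX natrM.
have -> : ln p = - l by rewrite lE opprK.
lra.
Qed.

(** * Numerical estimates and conclusion *)

(** Since r! >= 2. The resulting p <= 1/2 keeps log(n^r/e) away from 0 and makes p^2 at most p/2. *)
Lemma card_uniform_le (R : realFieldType) (V : finType) (k : nat) (G : {set {set V}}) :
  r_uniform k.+2 G -> #|G|%:R <= #|V|%:R ^+ k.+2 / 2 :> R.
Proof.
move=> unifG; rewrite ler_pdivlMr // -natrX -natrM ler_nat.
apply: leq_trans (ffact_le_expn _ _); rewrite -bin_ffact -card_draws leq_mul //.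
  by apply/subset_leq_card/fintype.subsetP => A /unifG cA; rewrite inE cA.
by rewrite factS -[leqLHS]muln1 leq_mul ?fact_gt0.
Qed.

Lemma expr_near1_ge (R : realFieldType) (k : nat) (h : R) :
  h <= 1 -> 1 - k%:R * h <= (1 - h) ^+ k.
Proof.
move=> h1; have := @expr_ge_tangent R (1 - h) 1 k.
rewrite subr_ge0 expr1n => /(_ h1 ler01); rewrite expr1n mulr1 addrAC subrr add0r mulrN.
by [].
Qed.

(** Compare cubes: [p ^+ (2 * s ^ k)] cubed has exponent 6 s^k <= (6s)^k, so it is at least 1/N, and
    multiplying by N^3 leaves N^2 = M^3. *)
Lemma blowup_density_ge (R : realFieldType) (k s : nat) (N p b M : R) :
  (0 < k)%N -> 0 < N -> 0 < p -> p <= 1 -> p ^+ 2 <= b ->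
  0 <= M -> M ^+ 3 = N ^+ 2 -> 1 <= p ^+ ((6 * s) ^ k) * N ->
  M <= b ^+ (s ^ k) * N.
Proof.
move=> k0 N0 p0 p1 le_b M0 MN pN.
have p20 : 0 <= p ^+ 2 by rewrite exprn_ge0 // ltW.
have b0 : 0 <= b := le_trans p20 le_b.
have w0 : 0 <= p ^+ (2 * s ^ k) by rewrite exprn_ge0 // ltW.
apply: (@le_trans _ _ (p ^+ (2 * s ^ k) * N)); last first.
  rewrite ler_wpM2r ?(ltW N0) // exprM.
  by apply: lerXn2r le_b; rewrite nnegrE.
have w3 : 1 <= (p ^+ (2 * s ^ k)) ^+ 3 * N.
  apply: le_trans pN _; rewrite ler_wpM2r ?(ltW N0) // -exprM.
  apply: ler_wiXn2l; rewrite ?(ltW p0) //.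
  rewrite expnMn mulnAC leq_mul2r; apply/orP; right.
  by rewrite -[leqLHS]/(6 ^ 1)%N leq_exp2l.
rewrite -(ler_pXn2r (ltn0Sn 2)) ?nnegrE ?mulr_ge0 ?(ltW N0) // MN exprMn.
by rewrite (exprS N 2) mulrA ler_peMl ?exprn_ge0 ?(ltW N0).
Qed.

(** The classes of size t cost at most u/(6r) * (21/20) q * 2re/(uq) = (7/20) e, where 21/20 pays
    for rounding t. The classes of size s cost at most e/200, because u s N^k <= e/100. *)
Lemma few_removed_edges (R : realFieldType) (k i s t : nat) (N e u q c : R) :
  0 < N -> 0 < e -> 0 < u -> 0 < q -> 0 < c -> u * q <= N ->
  N ^+ k.+1 <= e * c -> s%:R * c <= q / 100 -> t%:R <= 21 / 20 * q ->
  i%:R <= (6 * k.+1%:R)^-1 * u ->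
  i%:R * (k%:R * s%:R * N ^+ k + t%:R * (2 * k.+1%:R * e / (u * q))) <= 71 / 200 * e.
Proof.
move=> N0 e0 u0 q0 c0 uqN Nec sc tq iu.
have Nk0 : 0 <= N ^+ k by rewrite exprn_ge0 // ltW.
have k0 : 0 < k.+1%:R :> R by [].
have kk : k%:R <= k.+1%:R :> R by rewrite ler_nat.
have small_s : u * s%:R * N ^+ k <= e / 100.
  rewrite -(ler_pM2r c0); have := ler_wpM2r Nk0 (ler_wpM2l (ltW u0) sc).
  have := ler_wpM2r Nk0 uqN; rewrite -exprS => H1 H2; lra.
rewrite mulrDr; have -> : 71 / 200 * e = 1 / 200 * e + 7 / 20 * e by lra.
apply: lerD.
  apply: (@le_trans _ _ ((6 * k.+1%:R)^-1 * u * (k.+1%:R * s%:R * N ^+ k))).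
    rewrite ler_pM ?mulr_ge0 // ler_wpM2r // ler_wpM2r //.
  have -> : (6 * k.+1%:R)^-1 * u * (k.+1%:R * s%:R * N ^+ k) = u * s%:R * N ^+ k / 6.
    by field; rewrite lt0r_neq0.
  by lra.
apply: (@le_trans _ _ ((6 * k.+1%:R)^-1 * u *
    (21 / 20 * q * (2 * k.+1%:R * e / (u * q))))).
  have D0 : 0 <= 2 * k.+1%:R * e / (u * q) by rewrite ltW // divr_gt0 ?mulr_gt0.
  by apply: ler_pM => //; [exact: mulr_ge0|exact: ler_wpM2r].
rewrite le_eqVlt; apply/orP; left; apply/eqP; field.
by rewrite !lt0r_neq0.
Qed.

(* Here q = n^(1/r), u = (e/n)^(1/r), c = n^(1/6^(r-1)) and M = n^(2/3). *)
Lemma disjoint_copies_of_sizes (R : realFieldType) (V : finType) (j s t m : nat)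
    (G : {set {set V}}) (k := j.+1) (N e u q c M : R) :
  r_uniform k.+1 G -> N = #|V|%:R -> e = #|G|%:R -> (0 < s)%N -> (0 < t)%N ->
  0 < N -> 0 < u -> 0 < q -> 0 < c -> 0 <= M ->
  (u * q) ^+ k.+1 = e -> M ^+ 3 = N ^+ 2 -> N ^+ k.+1 <= e * c ->
  1 <= (e / N ^+ k.+1) ^+ ((6 * s) ^ k) * N ->
  s%:R * c <= q / 100 -> s%:R <= (50 * k%:R)^-1 * M ->
  t%:R <= 21 / 20 * q -> t%:R <= M ->
  (forall i, (i < m)%N -> i%:R < (6 * k.+1%:R)^-1 * u) ->
  has_disjoint_copies m (Kpartite (@sst k.+1 s t)) G.
Proof.
move=> unifG NV eG s0 t0 N0 u0 q0 c0 M0 uqX MN Nec pN sc sM tq tM iu.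
have e0 : 0 < e by rewrite -uqX exprn_gt0 // mulr_gt0.
have Nk0 : 0 < N ^+ k.+1 by rewrite exprn_gt0.
have le_e : e <= N ^+ k.+1 / 2 by rewrite eG NV card_uniform_le.
have p2 : e / N ^+ k.+1 <= 1 / 2 by rewrite ler_pdivrMr //; clear -le_e; lra.
have p0 : 0 < e / N ^+ k.+1 by rewrite divr_gt0.
(* With this choice the k factors [1 - h] cost at most 1/50 in total, and 49/50 * 13/25 still
   exceeds 1/2 >= p. *)
set h := (50 * k%:R)^-1 in sM.
have k1 : 1 <= k%:R :> R by rewrite ler1n.
have h0 : 0 < h by rewrite invr_gt0; lra.
have kh : k%:R * h = 1 / 50 by rewrite /h; field; rewrite lt0r_neq0 //; lra.
have h1 : h <= 1 by have : 1 * h <= k%:R * h; [rewrite ler_wpM2r // ltW | lra].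
have h01 : 0 <= h <= 1 by rewrite (ltW h0).
have hk : 49 / 50 <= (1 - h) ^+ k by have := expr_near1_ge k h1; rewrite kh; clear; lra.
set p := e / N ^+ k.+1 in pN p2 p0.
have p1 : p <= 1 by clear -p2; lra.
have le_p : p ^+ 2 <= (1 - h) ^+ k * (13 / 25 * p).
  apply: (@le_trans _ _ (49 / 50 * (13 / 25 * p))).
    by rewrite expr2; clear -p2 p0; nra.
  by apply: ler_wpM2r hk; clear -p0; lra.
have le_M := blowup_density_ge (ltn0Sn j) N0 p0 p1 le_p M0 MN pN.
have uqN : u * q <= N.
  by rewrite -(ler_pXn2r (ltn0Sn k)) ?nnegrE ?mulr_ge0 ?(ltW u0) ?(ltW q0) ?(ltW N0) // uqX; clear -le_e Nk0; lra.
have := card_heavy_edges unifG (mulr_gt0 u0 q0) (etrans uqX eG).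
set D : R := 2 * _ * _ / _; set L := [set v | _ < _] => heavy.
(* At most e/8 edges miss [L] and at most 71e/200 are destroyed; 1 - 1/8 - 71/200 = 13/25. *)
apply: (@disjoint_copies R V k s t m G L (13 / 25 * p) h D) => //.
- by rewrite -(ltr_nat R) -NV.
- by clear -p0 p2; lra.
- rewrite -NV -mulrA (le_trans sM) // ler_wpM2l ?(ltW h0) //.
- by rewrite -NV (le_trans tM).
- by move=> v; rewrite inE => /ltW.
move=> i /iu /ltW le_i; rewrite -NV.
have := few_removed_edges N0 e0 u0 q0 c0 uqN Nec sc tq le_i.
rewrite eG -/D -eG.
have -> : 13 / 25 * p * N ^+ k.+1 = 13 / 25 * e.
  by rewrite -mulrA /p mulfVK // lt0r_neq0.
have cG : e = #|[set A in G | [disjoint A & L]]|%:R + #|[set A in G | ~~ [disjoint A & L]]|%:R.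
  rewrite eG -natrD -(cardsID [set A : {set V} | [disjoint A & L]]); congr (_ + _)%:R.
    by apply: eq_card => A; rewrite !inE.
  by apply: eq_card => A; rewrite !inE andbC.
move: heavy; rewrite -eG; move: cG.
set x := #|_|%:R; set y := #|_|%:R; clear; lra.
Qed.

Theorem theoremA3 (R : realType) (r : nat) (hr : (2 <= r)%N) :
  exists n0 : nat, forall n : nat, (n0 <= n)%N ->
  forall (V : finType) (G : {set {set V}}),
    #|V| = n -> r_uniform r G ->
    n%:R `^ (r%:R - 1 / 6%:R ^+ (r - 1)) <= #|G|%:R :> R ->
    has_disjoint_copies (natceil (num_copies R r n #|G|))
      (@Kpartite r
        (sst (natceil (s_size R r n #|G|)) (natceil (t_size R r n)))) G.
Proof.
case: r hr => [|[|j]] // _; rewrite subn1 /=.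
set k := j.+1; set d : R := k.+1%:R^-1; set d6 : R := 1 / 6 ^+ k.
have k1 : 1 <= k%:R :> R by rewrite ler1n.
have kS : k.+1%:R = k%:R + 1 :> R by rewrite natr1.
have d0 : 0 < d by rewrite invr_gt0.
have d2 : d <= 1 / 2 by rewrite /d invf_ple ?posrE //; lra.
have d6d : d6 < d.
  rewrite /d6 mul1r ltf_pV2 ?posrE ?exprn_gt0 // -natrX ltr_nat.
  by rewrite /k; elim: (j) => // i IH; rewrite expnS; lia.
have h0 : 0 < (50 * k%:R)^-1 :> R by rewrite invr_gt0; lra.
have [n1 H1] := @powR_ge_eventually R 20 d d0.
have [||n2 H2] := @ln_le_powR_eventually R (1 / 100) (d - d6); [lra..|].
have [|n3 H3] := @ln_le_powR_eventually R _ (2 / 3) h0; first by lra.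
have [|n4 H4] := @powR_ge_eventually R 2 (2 / 3 - d); first by lra.
exists (n1 + n2 + n3 + n4 + 1)%N => n le_n V G cV unifG ge_e.
have {}H1 := H1 n ltac:(lia); have {}H2 := H2 n ltac:(lia).
have {}H3 := H3 n ltac:(lia); have {}H4 := H4 n ltac:(lia).
have n0 : (0 < n)%N by lia.
have N0 : 0 < n%:R :> R by rewrite ltr0n.
have nz : n%:R != 0 :> R by rewrite lt0r_neq0.
have e0 : 0 < #|G|%:R :> R by apply: lt_le_trans ge_e; rewrite powR_gt0.
have [s0 le_s pN] := s_size_bounds (ltn0Sn j) n0
  (etrans (esym (ltr0n R _)) e0) (eq_ind _ (fun x => _ <= x%:R ^+ _ / 2) (card_uniform_le R unifG) _ cV) ge_e.
have rootX (y : R) : 0 <= y -> (y `^ d) ^+ k.+1 = y.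
  by move=> y0; rewrite -powR_mulrn ?powR_ge0 // -powRrM mulVf ?powRr1.
have q0 : 0 < n%:R `^ d by rewrite powR_gt0.
have u0 : 0 < (#|G|%:R / n%:R) `^ d :> R by rewrite powR_gt0 // divr_gt0.
have tq : (natceil (t_size R k.+1 n))%:R <= 21 / 20 * n%:R `^ d.
  by have := natceil_lt (ltW q0); rewrite /t_size -/d; clear -H1; lra.
apply: (@disjoint_copies_of_sizes R V j _ _ _ G n%:R #|G|%:R
  ((#|G|%:R / n%:R) `^ d) (n%:R `^ d) (n%:R `^ d6) (n%:R `^ (2 / 3))) => //.
- by rewrite cV.
- by rewrite ltn_natceil ?powR_ge0 // powR_gt0.
- by rewrite powR_gt0.
- rewrite exprMn !rootX ?(ltW N0) ?(ltW (divr_gt0 e0 N0)) //.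
  by rewrite mulfVK.
- rewrite -powR_mulrn ?powR_ge0 // -powRrM -powR_mulrn ?(ltW N0) //.
  by congr (_ `^ _); rewrite divfK.
- have := ler_wpM2r (powR_ge0 n%:R d6) ge_e.
  by rewrite -powRD ?nz ?implybT // subrK powR_mulrn ?(ltW N0).
- apply: (@le_trans _ _ (1 / 100 * n%:R `^ (d - d6) * n%:R `^ d6)).
    by rewrite ler_wpM2r ?powR_ge0 // (le_trans le_s).
  by rewrite -mulrA -powRD ?nz ?implybT // subrK mulrC mul1r.
- exact: le_trans le_s H3.
- have -> : n%:R `^ (2 / 3) = n%:R `^ (2 / 3 - d) * n%:R `^ d :> R.
    by rewrite -powRD ?nz ?implybT // subrK.
  by have := ler_wpM2r (ltW q0) H4; clear -tq q0; lra.
move=> i im; rewrite -ltn_natceil // mulr_ge0 ?(ltW u0) // invr_ge0 mulr_ge0.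
Qed.
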